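(* Let $N\ge2$, and let $t_i>0$ for $1\le i\le N$. The Jacobians (with gradients as columns) of the vectors of constraints $$c_I(\chi)=\frac12\begin{bmatrix}\|x_0^1-c_I\|_{E_I}^2-1 \\ \|\Phi(t_N,x_0^N)-c_U\|_{E_U}^2-1\end{bmatrix},\qquad c_E(\chi)=\begin{bmatrix}x_0^2-\Phi(t_1,x_0^1) \\ x_0^3-\Phi(t_2,x_0^2) \\ \vdots \\ x_0^N-\Phi(t_{N-1},x_0^{N-1})\end{bmatrix}$$ with respect to $\chi=[x_0^1,t_1,\ldots,x_0^N,t_N]^T$ are $$B_I(\chi)=\begin{bmatrix}E_I(x_0^1-c_I) & 0 \\ 0 & \vdots \\ \vdots & S(t_N,x_0^N)^TE_U\left(\Phi(t_N,x_0^N)-c_U\right) \\ 0 & \frac{d\Phi(t_N,x_0^N)}{dt_N}^TE_U\left(\Phi(t_N,x_0^N)-c_U\right)\end{bmatrix}\in\mathbb{R}^{N(n+1)\times 2}$$ (in the first column only the rows of $x_0^1$, and in the second column only the rows of $x_0^N$ and $t_N$, carry the displayed entries; all other entries are zero), and $$B_E(\chi)=\begin{bmatrix}-S(t_1,x_0^1)^T & & & \\ -\frac{d\Phi(t_1,x_0^1)}{dt_1}^T & & & \\ I & -S(t_2,x_0^2)^T & & \\ & -\frac{d\Phi(t_2,x_0^2)}{dt_2}^T & & \\ & I & & \\ & & \ddots & \\ & & & -S(t_{N-1},x_0^{N-1})^T \\ & & & -\frac{d\Phi(t_{N-1},x_0^{N-1})}{dt_{N-1}}^T \\ & & & I \\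 & & & 0\end{bmatrix}\in\mathbb{R}^{N(n+1)\times(N-1)n},$$ i.e. the $i$th block column ($n$ columns, $1\le i\le N-1$) of $B_E(\chi)$ has $-S(t_i,x_0^i)^T$ in the rows of $x_0^i$, $-\frac{d\Phi(t_i,x_0^i)}{dt_i}^T$ in the row of $t_i$, the identity matrix $I\in\mathbb{R}^{n\times n}$ in the rows of $x_0^{i+1}$, and zeros elsewhere.
   Context: Let $f:\mathbb{R}^n\to\mathbb{R}^n$ be continuously differentiable and let $\Phi:\mathbb{R}\times\mathbb{R}^n\to\mathbb{R}^n$ be the flow of $\dot x=f(x(t))$, i.e. $\Phi(0,x_0)=x_0$ and $\Phi(t,x_0)=x(t)$ for the solution $x$ with initial state $x_0$. The sensitivity function is $S(t,x_0)=\frac{\partial\Phi(t,x_0)}{\partial x_0}\in\mathbb{R}^{n\times n}$ (entry $(j,k)$ is $\partial x_j(t)/\partial x_{0,k}$). $E_I,E_U\in\mathbb{R}^{n\times n}$ are symmetric positive definite, $c_I,c_U\in\mathbb{R}^n$ (the centre $c_I\in\mathbb{R}^n$ is distinct from the constraint function $c_I(\chi)$), and $\|v\|_E^2=v^TEv$. The parameter vector is $\chi=[x_0^1,t_1,\ldots,x_0^N,t_N]^T\in\mathbb{R}^{N(n+1)}$ with $x_0^i\in\mathbb{R}^n$ and $t_i\in\mathbb{R}$. Standing assumption: the constraint functions are twice continuously differentiable. Convention: the Jacobian of a vector of constraints $g:\mathbb{R}^k\to\mathbb{R}^m$ is the $k\times m$ matrix whose $(j,l)$ entry is $\partial g_l/\partial\chi_j$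 (column $l$ is the gradient of $g_l$). *)

(* Defs.v *)
From mathcomp Require Import all_boot all_order all_algebra.
From mathcomp Require Import sesquilinear.
From mathcomp Require Import all_classical all_reals all_analysis.

Set Implicit Arguments.
Unset Strict Implicit.
Unset Printing Implicit Defensive.

Import Order.TTheory GRing.Theory Num.Theory.
Import numFieldNormedType.Exports.
Local Open Scope ring_scope.
Local Open Scope classical_set_scope.

(* Elements of R^k are row vectors ['rV[R]_k], the library's setting for       *)
(* Jacobians: with [f u = f p + (u - p) *m 'J f p + o(u - p)], the entry (j, l) *)
(* of ['J f p : 'M_(k, m)] is the partial derivative of f_l along the j-th      *)
(* coordinate, so the columns of ['J f p] are the gradients of the f_l.         *)

Fixpoint times_continuously_differentiable (R : realType) (r k m : nat)
    (g : 'rV[R]_k -> 'rV[R]_m) : Prop :=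
  if r is r'.+1 then
    (forall p, differentiable g p) /\
    times_continuously_differentiable r' (fun p => mxvec ('J g p))
  else continuous g.

(* The global flow of x' = f(x). *)
Definition is_flow (R : realType) (n : nat) (f : 'rV[R]_n -> 'rV[R]_n)
    (Phi : R -> 'rV[R]_n -> 'rV[R]_n) : Prop :=
  (forall x0, Phi 0 x0 = x0) /\
  (forall x0 (t : R), is_derive t 1 (Phi ^~ x0) (f (Phi t x0))).

(* Transposed, so that entry (j, k) is the derivative of Phi_j along x0_k. *)
Definition sensitivity (R : realType) (n : nat)
    (Phi : R -> 'rV[R]_n -> 'rV[R]_n) (t : R) (x0 : 'rV[R]_n) : 'M[R]_n :=
  ('J (Phi t) x0)^T.

(* The time derivative of the flow, as a column vector. *)
Definition flow_dt (R : realType) (n : nat)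
    (Phi : R -> 'rV[R]_n -> 'rV[R]_n) (t : R) (x0 : 'rV[R]_n) : 'cV[R]_n :=
  (derive1 (Phi ^~ x0) t)^T.

(* For the row vector v, this is the square of the E-norm of v^T. *)
Definition sqnorm (R : realType) (n : nat) (E : 'M[R]_n) (v : 'rV[R]_n) : R :=
  (v *m E *m v^T) 0 0.

Definition sym_posdef (R : realType) (n : nat) (E : 'M[R]_n) : Prop :=
  E \is symmetricmx /\ (forall v : 'rV[R]_n, v != 0 -> 0 < sqnorm E v).

(* Indices are 0-based: shot i : 'I_N is the (i+1)-th one, and the j-th         *)
(* matching condition, j : 'I_N.-1, relates the shots j and j+1.                *)

Definition first_shot (N : nat) (hN : (2 <= N)%N) : 'I_N := Ordinal (ltnW hN).

Fact last_shot_subproof (N : nat) : (2 <= N)%N -> (N.-1 < N)%N.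
Proof. by case: N. Qed.

Definition last_shot (N : nat) (hN : (2 <= N)%N) : 'I_N :=
  Ordinal (last_shot_subproof hN).

Definition this_shot (N : nat) (j : 'I_N.-1) : 'I_N :=
  widen_ord (leq_pred N) j.

Fact next_shot_subproof (N : nat) (j : 'I_N.-1) : (j.+1 < N)%N.
Proof. by rewrite -ltn_predRL. Qed.

Definition next_shot (N : nat) (j : 'I_N.-1) : 'I_N :=
  Ordinal (next_shot_subproof j).

(* The dimension N(n+1), in the form used by the library's block matrices: N    *)
(* consecutive blocks of size n+1.  Block i of chi is [x_0^i, t_i].             *)
Notation shots_dim N n := (\sum_(i < N) (n + 1))%N.
Notation match_dim N n := (\sum_(j < N.-1) n)%N.

Definition shot_block (R : realType) (N n : nat)
    (chi : 'rV[R]_(shots_dim N n)) (i : 'I_N) : 'rV[R]_(n + 1) :=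
  submxrow (q_ := fun=> (n + 1)%N) chi i.

Definition shot_state (R : realType) (N n : nat)
    (chi : 'rV[R]_(shots_dim N n)) (i : 'I_N) : 'rV[R]_n :=
  lsubmx (shot_block chi i).

Definition shot_time (R : realType) (N n : nat)
    (chi : 'rV[R]_(shots_dim N n)) (i : 'I_N) : R :=
  rsubmx (shot_block chi i) 0 0.

Definition ineq_constraints (R : realType) (N n : nat) (hN : (2 <= N)%N)
    (Phi : R -> 'rV[R]_n -> 'rV[R]_n) (EI EU : 'M[R]_n) (cI cU : 'rV[R]_n)
    (chi : 'rV[R]_(shots_dim N n)) : 'rV[R]_2 :=
  let x1 := shot_state chi (first_shot hN) in
  let xN := shot_state chi (last_shot hN) in
  let tN := shot_time chi (last_shot hN) in
  2^-1 *: row_mx (sqnorm EI (x1 - cI) - 1)%:M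
                 (sqnorm EU (Phi tN xN - cU) - 1)%:M.

Definition eq_constraints (R : realType) (N n : nat)
    (Phi : R -> 'rV[R]_n -> 'rV[R]_n)
    (chi : 'rV[R]_(shots_dim N n)) : 'rV[R]_(match_dim N n) :=
  \mxrow_(j < N.-1)
    (shot_state chi (next_shot j) -
     Phi (shot_time chi (this_shot j)) (shot_state chi (this_shot j))).

Definition ineq_matrix (R : realType) (N n : nat) (hN : (2 <= N)%N)
    (Phi : R -> 'rV[R]_n -> 'rV[R]_n) (EI EU : 'M[R]_n) (cI cU : 'rV[R]_n)
    (chi : 'rV[R]_(shots_dim N n)) : 'M[R]_(shots_dim N n, 2) :=
  let x1 := shot_state chi (first_shot hN) in
  let xN := shot_state chi (last_shot hN) in
  let tN := shot_time chi (last_shot hN) in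
  row_mx
    (\mxcol_(i < N)
       if i == first_shot hN then
         (col_mx (EI *m (x1 - cI)^T) 0 : 'cV[R]_(n + 1))
       else 0)
    (\mxcol_(i < N)
       if i == last_shot hN then
         (col_mx ((sensitivity Phi tN xN)^T *m EU *m (Phi tN xN - cU)^T)
                 ((flow_dt Phi tN xN)^T *m EU *m (Phi tN xN - cU)^T)
          : 'cV[R]_(n + 1))
       else 0).

Definition eq_matrix (R : realType) (N n : nat)
    (Phi : R -> 'rV[R]_n -> 'rV[R]_n)
    (chi : 'rV[R]_(shots_dim N n)) : 'M[R]_(shots_dim N n, match_dim N n) :=
  \mxblock_(i < N, j < N.-1)
    let x := shot_state chi (this_shot j) in
    let t := shot_time chi (this_shot j) in
    if i == this_shot j then
      (col_mx (- (sensitivity Phi t x)^T) (- (flow_dt Phi t x)^T)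
       : 'M[R]_(n + 1, n))
    else if i == next_shot j then col_mx 1%:M 0
    else 0.

(* Main.v *)
(* Smoothness of the matching conditions c_E makes the joint map             *)
(* (x, t) |-> Phi t x differentiable: restrict c_E to the vectors chi that   *)
(* vanish outside the first shot. Both Jacobians then follow from the chain  *)
(* rule, as 'd Phi (v, s) is S v + s dPhi/dt and the differential of         *)
(* |x|_E^2 / 2 is v |-> v^T E x when E is symmetric.                         *)

From HB Require Import structures.
Require Import Defs.
From mathcomp Require Import all_boot all_order all_algebra.
From mathcomp Require Import sesquilinear.
From mathcomp Require Import all_classical all_reals all_analysis.

Import Order.TTheory GRing.Theory Num.Theory.
Import numFieldNormedType.Exports.
Local Open Scope ring_scope.

(** A matrix is determined by its products with row vectors, and [v *m 'J g p] is the differential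
    of [g] at [p] along [v]; so both equalities amount to computing differentials and reading them
    block by block. The missing input is differentiability of the flow in state and time together.
    [differentiable_joint_flow] extracts it from the first matching condition, which reduces to
    minus the flow when the second state is zero. Then [diff_joint_flow] splits the differential
    into its state and time parts, and [is_diff_half_sqnorm] handles the quadratic forms. *)

Lemma is_diff_linear_rV (R : realFieldType) (k : nat) (V : normedModType R)
  (g : 'rV[R]_k -> V) (x : 'rV[R]_k) : linear g -> is_diff x g g.
Proof.
move=> glin.
pose gL : {linear 'rV[R]_k -> V} :=
  HB.pack g (GRing.isLinear.Build _ _ _ _ _ glin).
(* In finite dimension a linear map is a combination of coordinates. This gives the continuity
   needed to make [g] its own differential. *)
have gE : g = \sum_i (fun y : 'rV[R]_k => y 0 i *: g (delta_mx 0 i)).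
  apply/funext => y; rewrite fct_sumE -[LHS]/(gL y) {1}(row_sum_delta y).
  by rewrite linear_sum; apply: eq_bigr => i _; rewrite linearZ.
have gD y : differentiable g y.
  rewrite gE; apply: differentiable_sum => i.
  exact/differentiableZl/differentiable_coord.
have gC : continuous g by move=> y; exact: differentiable_continuous (gD y).
by apply: DiffDef => //; rewrite -[g]/(gL : _ -> _) diff_lin.
Qed.

Lemma is_diff_sum (R : numFieldType) (V W : normedModType R) (m : nat)
  (f df : 'I_m -> V -> W) (x : V) :
  (forall i, is_diff x (f i) (df i)) ->
  is_diff x (\sum_i f i) (\sum_i df i).
Proof.
move=> fP; elim/big_ind2: _ => [|? ? ? ? ? ?|i _].
- exact: is_diff_cst.
- exact: is_diffD.
- exact: fP.
Qed.

Lemma jacobian_is_diff {R : numFieldType} {k m : nat}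
  {g dg : 'rV[R]_k -> 'rV[R]_m} {p : 'rV[R]_k} (v : 'rV[R]_k) :
  is_diff p g dg -> v *m 'J g p = dg v.
Proof. by move=> gP; rewrite mul_rV_lin1 diff_val. Qed.

Lemma is_diff_sqnorm {R : realType} {n : nat} {E : 'M[R]_n} (x : 'rV[R]_n) :
  E \is symmetricmx ->
  is_diff x (sqnorm E) (fun v => 2 * (v *m E *m x^T) 0 0).
Proof.
move=> symE.
(* [symmetricmx] means hermitian for the sign [(-1) ^+ 0] and the identity automorphism. *)
have ET : E^T = E.
  by move/is_hermitianmxP: symE => {2}->; rewrite expr0 scale1r map_mx_id.
have -> : sqnorm E =
    \sum_i (fun v : 'rV[R]_n => (v *m E) 0 i) * (fun v : 'rV[R]_n => v 0 i).
  apply/funext => v; rewrite fct_sumE /sqnorm mxE.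
  by apply: eq_bigr => i _; rewrite [v^T _ _]mxE.
apply: is_diff_eq.
  apply: is_diff_sum => i; apply: is_diffM; apply: is_diff_linear_rV => a u v.
    by rewrite mulmxDl -scalemxAl !mxE.
  by rewrite !mxE.
apply/funext => v; rewrite fct_sumE /=.
(* The product rule yields two bilinear terms; they are transposes of each other because [E] is
   symmetric. *)
transitivity ((x *m E *m v^T) 0 0 + (v *m E *m x^T) 0 0).
  rewrite [in RHS]mxE [X in _ + X]mxE -big_split /=; apply: eq_bigr => i _.
  rewrite ![_^T _ _]mxE; congr (_ + _); exact: mulrC.
have -> : x *m E *m v^T = (v *m E *m x^T)^T.
  by rewrite !trmx_mul trmxK ET mulmxA.
by rewrite mxE -mulr2n mulr_natl.
Qed.

Lemma is_diff_addr_cst {R : numFieldType} {V W : normedModType R}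
  {g dg : V -> W} {x : V} (c : W) :
  is_diff x g dg -> is_diff x (fun u => g u + c) dg.
Proof. by move=> gP; have := is_diffD gP (is_diff_cst c x); rewrite addr0. Qed.

(** The factor 1/2 cancels the 2 from the quadratic form. A general [g] covers both the initial
    state, which is linear in [chi], and the end point of the flow. *)
Lemma is_diff_half_sqnorm {R : realType} {U : normedModType R} {n : nat}
  {E : 'M[R]_n} {g dg : U -> 'rV[R]_n} {x : U} (c : 'rV[R]_n) :
  E \is symmetricmx -> is_diff x g dg ->
  is_diff x (fun u => 2^-1 * (sqnorm E (g u - c) - 1))
    (fun v => (dg v *m E *m (g x - c)^T) 0 0).
Proof.
move=> symE /(is_diff_addr_cst (- c)) gP.
have sqP := is_diff_addr_cst (- (1 : R))
  (is_diff_comp gP (is_diff_sqnorm (g x - c) symE)).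
apply: (is_diff_eq (is_diff_comp sqP (is_diff_scaler 2^-1 _))).
by apply/funext => v; rewrite /= scalerA mulVf ?scale1r // pnatr_eq0.
Qed.

Section Flow.
Context {R : realType} {n : nat} (Phi : R -> 'rV[R]_n -> 'rV[R]_n).

(* The pair (x, t) is encoded as one row vector, as in the blocks of chi. *)
Definition joint_flow (y : 'rV[R]_(n + 1)) : 'rV[R]_n :=
  Phi (rsubmx y 0 0) (lsubmx y).

(** By linearity it suffices to treat the directions [(u, 0)] and [(0, s)]. The chain rule along the
    affine slices through [y] identifies these values with the derivatives of [Phi t] and of
    [Phi ^~ x]. *)
Lemma diff_joint_flow (y v : 'rV[R]_(n + 1)) :
  differentiable joint_flow y ->
  'd joint_flow y v =
  v *m col_mx (sensitivity Phi (rsubmx y 0 0) (lsubmx y))^T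
              (flow_dt Phi (rsubmx y 0 0) (lsubmx y))^T.
Proof.
set t := rsubmx y 0 0; set x := lsubmx y => Gd.
have yE : y = row_mx x t%:M.
  by rewrite -[LHS]hsubmxK [rsubmx y]mx11_scalar.
have PhiE t' x' : Phi t' x' = joint_flow (row_mx x' t'%:M).
  by rewrite /joint_flow row_mxKl row_mxKr mxE eqxx mulr1n.
have dx : is_diff x (Phi t) (fun u => 'd joint_flow y (row_mx u 0)).
  have rowP : is_diff x (fun u => row_mx u 0 + row_mx 0 t%:M)
                (fun u => row_mx u 0 : 'rV[R]_(n + 1)).
    apply/is_diff_addr_cst/is_diff_linear_rV => a u w.
    by rewrite scale_row_mx add_row_mx scaler0 addr0.
  have -> : Phi t = joint_flow \o (fun u => row_mx u 0 + row_mx 0 t%:M).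
    by apply/funext => u; rewrite PhiE /= add_row_mx addr0 add0r.
  apply: (is_diff_comp rowP).
  by rewrite add_row_mx addr0 add0r -yE; exact: differentiableP.
have dt : is_diff t (Phi ^~ x) (fun s => 'd joint_flow y (row_mx 0 s%:M)).
  have scalarE (s : R) : s *: row_mx 0 1%:M = row_mx 0 s%:M :> 'rV[R]_(n + 1).
    by rewrite scale_row_mx scaler0 scalemx1.
  have rowP : is_diff t (fun s => row_mx 0 s%:M + row_mx x 0)
                (fun s => row_mx 0 s%:M : 'rV[R]_(n + 1)).
    apply: is_diff_addr_cst.
    have -> : (fun s => row_mx 0 s%:M) =
        *:%R ^~ (row_mx 0 1%:M : 'rV[R]_(n + 1)).
      by apply/funext => s; rewrite scalarE.
    exact: is_diff_scalel.
  have -> : Phi ^~ x = joint_flow \o (fun s => row_mx 0 s%:M + row_mx x 0).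
    by apply/funext => s; rewrite PhiE /= add_row_mx addr0 add0r.
  apply: (is_diff_comp rowP).
  by rewrite add_row_mx addr0 add0r -yE; exact: differentiableP.
rewrite -[v in LHS]hsubmxK -[v in RHS]hsubmxK mul_row_col !trmxK.
rewrite (jacobian_is_diff (lsubmx v) dx) derive1E' ?diff_val; last by case: dt.
rewrite [rsubmx v]mx11_scalar mul_scalar_mx -linearZ scale_row_mx scaler0.
by rewrite scalemx1 -linearD add_row_mx addr0 add0r.
Qed.

End Flow.

(** Basis row vectors pick out the rows. This turns an equality of Jacobians into one of
    differentials. *)
Lemma mulmx_ext (R : nzSemiRingType) (k m : nat) (A B : 'M[R]_(k, m)) :
  (forall v : 'rV_k, v *m A = v *m B) -> A = B.
Proof. by move=> AB; apply/row_matrixP => i; rewrite !rowE. Qed.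

Section Shots.
Context {R : realType} {N n : nat}.
Implicit Types (chi v : 'rV[R]_(shots_dim N n)) (i : 'I_N).

Lemma is_diff_shot_block chi i :
  is_diff chi (fun c : 'rV[R]_(shots_dim N n) => shot_block c i)
    (fun v => shot_block v i).
Proof. by apply: is_diff_linear_rV => a u v; apply/rowP => k; rewrite !mxE. Qed.

Lemma is_diff_shot_state chi i :
  is_diff chi (fun c : 'rV[R]_(shots_dim N n) => shot_state c i)
    (fun v => shot_state v i).
Proof. by apply: is_diff_linear_rV => a u v; apply/rowP => k; rewrite !mxE. Qed.

Lemma mul_rV_shots m v (B : forall i : 'I_N, 'M[R]_(n + 1, m)) :
  v *m \mxcol_i B i = \sum_i shot_block v i *m B i.
Proof. by rewrite -mul_mxrow_mxcol /shot_block submxrowK. Qed.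

Lemma mul_rV_shots_delta m v i0 (B : 'M[R]_(n + 1, m)) :
  v *m (\mxcol_(i < N) if i == i0 then B else 0) = shot_block v i0 *m B.
Proof.
rewrite mul_rV_shots (bigD1 i0) //= eqxx big1 ?addr0 // => i /negPf ->.
by rewrite mulmx0.
Qed.

Context (Phi : R -> 'rV[R]_n -> 'rV[R]_n).

Lemma joint_flow_shot chi i :
  joint_flow Phi (shot_block chi i) = Phi (shot_time chi i) (shot_state chi i).
Proof. by []. Qed.

Lemma differentiable_joint_flow :
  (2 <= N)%N -> (forall p, differentiable (@eq_constraints R N n Phi) p) ->
  forall y, differentiable (joint_flow Phi) y.
Proof.
move=> hN cED y.
have N1_gt0 : (0 < N.-1)%N by rewrite ltn_predRL.
(* Since [N] is at least 2, there is a first matching condition; [emb] fills the first shot and puts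
   zero in all others. *)
pose j0 := Ordinal N1_gt0.
pose emb (y : 'rV[R]_(n + 1)) : 'rV[R]_(shots_dim N n) :=
  \mxrow_i (if i == this_shot j0 then y else 0).
have embK u i : shot_block (emb u) i = if i == this_shot j0 then u else 0.
  by rewrite /shot_block mxrowK.
have -> : joint_flow Phi =
    fun u => - submxrow (q_ := fun=> n) (eq_constraints Phi (emb u)) j0.
  (* [this_shot j0] and [next_shot j0] have indices 0 and 1, so the next state vanishes on the image
     of [emb]. *)
  apply/funext => u; rewrite mxrowK -joint_flow_shot /shot_state !embK.
  by rewrite eqxx linear0 sub0r opprK.
apply: differentiableN.
have embP : is_diff y emb emb.
  apply: is_diff_linear_rV => a u w; apply/rowP => k; rewrite !mxE.
  by case: eqP => _; rewrite !mxE // mulr0 addr0.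
have subP p : is_diff p (fun c => submxrow (q_ := fun=> n) c j0 : 'rV[R]_n)
                (fun u => submxrow u j0).
  by apply: is_diff_linear_rV => a u w; apply/rowP => k; rewrite !mxE.
have embcP := is_diff_comp embP (differentiableP (cED (emb y))).
have := is_diff_comp embcP (subP _).
by case.
Qed.

Lemma jacobian_eq_constraints chi :
  (2 <= N)%N -> (forall p, differentiable (@eq_constraints R N n Phi) p) ->
  'J (@eq_constraints R N n Phi) chi = eq_matrix Phi chi.
Proof.
move=> hN cED; apply: mulmx_ext => v; apply/mxrowP => j.
have GD := differentiable_joint_flow hN cED (shot_block chi (this_shot j)).
rewrite mul_rV_lin1 -[v in RHS]submxrowK mul_mxrow_mxblock mxrowK.
transitivity (shot_state v (next_shot j) -
  'd (joint_flow Phi) (shot_block chi (this_shot j))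
    (shot_block v (this_shot j))).
  have subP : is_diff (eq_constraints Phi chi)
      (fun c => submxrow (q_ := fun=> n) c j : 'rV[R]_n)
      (fun u => submxrow u j).
    by apply: is_diff_linear_rV => a u w; apply/rowP => k; rewrite !mxE.
  have := is_diff_comp (differentiableP (cED chi)) subP.
  have -> : (fun c => submxrow (q_ := fun=> n) c j : 'rV[R]_n) \o
      eq_constraints Phi =
      (fun c : 'rV[R]_(shots_dim N n) => shot_state c (next_shot j)) -
      (joint_flow Phi \o (fun c => shot_block c (this_shot j))).
    by apply/funext => c; rewrite /= mxrowK.
  have shotP := is_diffB (is_diff_shot_state chi (next_shot j))
    (is_diff_comp (is_diff_shot_block chi (this_shot j)) (differentiableP GD)).
  (* Block [j] of the constraints now has two expressions for its differential: a block of that of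
     [eq_constraints], and the one in [shotP]. They are compared at [v]. *)
  by case=> _; rewrite diff_val => /(congr1 (@^~ v)) /esym.
(* In block column [j] only the rows of shots [j] and [j + 1] contribute, and these are distinct. *)
rewrite diff_joint_flow // (bigD1 (this_shot j)) //= eqxx.
rewrite (bigD1 (next_shot j)) /=; last first.
  by rewrite -val_eqE /= neq_ltn ltnSn orbT.
rewrite -val_eqE /= gtn_eqF // eqxx big1 ?addr0; last first.
  by move=> i /andP[/negPf -> /negPf ->]; rewrite mulmx0.
rewrite -opp_col_mx mulmxN addrC; congr (_ - _).
by rewrite -[submxrow v _]hsubmxK mul_row_col mulmx1 mulmx0 addr0.
Qed.

Lemma jacobian_ineq_constraints (hN : (2 <= N)%N) (EI EU : 'M[R]_n)
  (cI cU : 'rV[R]_n) chi :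
  EI \is symmetricmx -> EU \is symmetricmx ->
  (forall y, differentiable (joint_flow Phi) y) ->
  differentiable (ineq_constraints hN Phi EI EU cI cU) chi ->
  'J (ineq_constraints hN Phi EI EU cI cU) chi
    = ineq_matrix hN Phi EI EU cI cU chi.
Proof.
move=> symEI symEU GD cID; apply: mulmx_ext => v; apply/rowP => k.
rewrite mul_rV_lin1.
(* The cast exposes the width 2 of [ineq_matrix] as 1 + 1 for [mul_mx_row]. *)
rewrite [RHS](congr1 (fun M : 'rV[R]_(1 + 1) => M 0 k) (mul_mx_row v _ _)).
have coordP p : is_diff p (fun c : 'rV[R]_2 => c 0 k) (fun u => u 0 k).
  by apply: is_diff_linear_rV => a u w; rewrite !mxE.
have := is_diff_comp (differentiableP cID) (coordP _).
(* The two columns: the initial ellipsoid, then the terminal one. *)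
case: (split_ordP (k : 'I_(1 + 1))) => i ->; rewrite !ord1 => -[_].
- rewrite (_ : _ \o ineq_constraints _ _ _ _ _ _ =
    fun c => 2^-1 * (sqnorm EI (shot_state c (first_shot hN) - cI) - 1));
    last first.
    by apply/funext => c; rewrite /= mxE row_mxEl mxE.
  have dP := is_diff_half_sqnorm cI symEI
               (is_diff_shot_state chi (first_shot hN)).
  rewrite diff_val => /(congr1 (@^~ v)) /= <-.
  rewrite row_mxEl mul_rV_shots_delta -[shot_block v _]hsubmxK mul_row_col.
  by rewrite mulmx0 addr0 mulmxA.
- rewrite (_ : _ \o ineq_constraints _ _ _ _ _ _ =
    fun c => 2^-1 *
      (sqnorm EU (joint_flow Phi (shot_block c (last_shot hN)) - cU) - 1));
    last first.
    by apply/funext => c; rewrite /= mxE row_mxEr mxE.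
  have endP := is_diff_comp (is_diff_shot_block chi (last_shot hN))
    (differentiableP (GD _)).
  have dP := is_diff_half_sqnorm cU symEU endP.
  rewrite diff_val => /(congr1 (@^~ v)) /= <-.
  rewrite row_mxEr mul_rV_shots_delta diff_joint_flow //.
  (* The state and time rows share the right factor [EU *m (Phi tN xN - cU)^T], which is pulled out
     of the block. *)
  by rewrite -!mul_col_mx !mulmxA.
Qed.

End Shots.

Theorem lemma2 (R : realType) (n N : nat) (hN : (2 <= N)%N)
  (f : 'rV[R]_n -> 'rV[R]_n) (Phi : R -> 'rV[R]_n -> 'rV[R]_n)
  (EI EU : 'M[R]_n) (cI cU : 'rV[R]_n)
  (hf : times_continuously_differentiable 1 f)
  (hPhi : is_flow f Phi)
  (hEI : sym_posdef EI) (hEU : sym_posdef EU)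
  (hcI : times_continuously_differentiable 2
           (ineq_constraints hN Phi EI EU cI cU))
  (hcE : times_continuously_differentiable 2
           (@eq_constraints R N n Phi))
  (chi : 'rV[R]_(shots_dim N n))
  (ht : forall i : 'I_N, 0 < shot_time chi i) :
  'J (ineq_constraints hN Phi EI EU cI cU) chi
    = ineq_matrix hN Phi EI EU cI cU chi /\
  'J (@eq_constraints R N n Phi) chi = eq_matrix Phi chi.
Proof.
have [cID _] := hcI; have [cED _] := hcE; split.
  apply: jacobian_ineq_constraints; [exact: hEI.1|exact: hEU.1| |exact: cID].
  exact: differentiable_joint_flow hN cED.
exact: jacobian_eq_constraints hN cED.
Qed.
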